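(* Let $h(m,n):=|W_n^{-1}(K_{1,m};132)|$. For all $m>1$ and $n>2$, $$h(m,n)=h(m,n-1)+h(m-1,n-2).$$
   Context: For $\pi=\pi_1\cdots\pi_n\in\mathcal{S}_n$, the digraph $D(\pi)$ has vertices $1,\dots,n$ and an arc from $j$ to $i$ whenever $i<j$ and $\pi_i<\pi_j$. The weighted competition graph $W(\pi)$ is the edge-weighted simple graph on the same vertices in which distinct $u,v$ are joined by an edge iff they have a common out-neighbor in $D(\pi)$, with weight equal to the number of common out-neighbors. $K_{1,m}$ is the star with one center and $m$ leaves, all edge weights $1$. $W_n^{-1}(K_{1,m};132)$ is the set of $\pi\in\mathcal{S}_n$ avoiding the pattern $132$ such that $W(\pi)$ is isomorphic, as an edge-weighted graph, to $K_{1,m}$ together with some number of isolated vertices. *)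

(* Defs.v *)
From mathcomp Require Import all_boot all_fingroup.

Set Implicit Arguments.
Unset Strict Implicit.
Unset Printing Implicit Defensive.

Section Permutation.
Variable n : nat.
Implicit Types (p : 'S_n) (u v i j : 'I_n).

(* Indices and values both range over {0, ..., n-1} instead of {1, ..., n}. *)
Definition arc p : rel 'I_n := fun j i => (i < j) && (p i < p j).

Definition common_out p u v : {set 'I_n} := [set i | arc p u i && arc p v i].

Definition avoids132 p : bool :=
  [forall i : 'I_n, forall j : 'I_n, forall k : 'I_n,
     ~~ [&& i < j, j < k, p i < p k & p k < p j]].

End Permutation.

(* The values of wgwt outside wgadj carry no meaning. *)
Record wgraph (T : Type) := WGraph {
  wgadj : rel T;
  wgwt : T -> T -> nat;
  wgadj_irr : irreflexive wgadj;
  wgadj_sym : symmetric wgadj;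
  wgwt_sym : forall x y, wgwt x y = wgwt y x }.

Definition wgiso (T U : finType) (G : wgraph T) (H : wgraph U) : bool :=
  [exists f : {ffun T -> U},
    [&& injectiveb f, [forall y, y \in codom f] &
        [forall x, forall y,
          (wgadj H (f x) (f y) == wgadj G x y) &&
          (wgadj G x y ==> (wgwt H (f x) (f y) == wgwt G x y))]]].

Lemma wgisoP (T U : finType) (G : wgraph T) (H : wgraph U) :
  reflect (exists f : T -> U,
    [/\ bijective f,
        forall x y, wgadj H (f x) (f y) = wgadj G x y
      & forall x y, wgadj G x y -> wgwt H (f x) (f y) = wgwt G x y])
    (wgiso G H).
Proof.
apply: (iffP existsP) => [[f /and3P[/injectiveP injf /forallP surf /forallP fP]]|].
  exists f; split=> [|x y|x y Gxy].
  - have fg y : f (iinv (surf y)) = y by rewrite f_iinv.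
    by exists (fun y => iinv (surf y)) => // x; apply: injf; rewrite fg.
  - by have /forallP/(_ y)/andP[/eqP] := fP x.
  - by have /forallP/(_ y)/andP[_ /implyP/(_ Gxy)/eqP] := fP x.
case=> f [[g fK gK] fadj fwt]; exists (finfun f); apply/and3P; split.
- by apply/injectiveP=> x y; rewrite !ffunE; apply: (can_inj fK).
- by apply/forallP=> y; apply/codomP; exists (g y); rewrite ffunE gK.
- apply/forallP=> x; apply/forallP=> y; rewrite !ffunE fadj eqxx /=.
  by apply/implyP=> /fwt ->.
Qed.

Section Competition.
Variables (n : nat) (p : 'S_n).

Definition cadj : rel 'I_n := fun u v => (u != v) && [exists i, i \in common_out p u v].
Definition cwt (u v : 'I_n) : nat := #|common_out p u v|.

Fact common_outC u v : common_out p u v = common_out p v u.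
Proof. by apply/setP=> i; rewrite !inE andbC. Qed.

Fact cadj_irr : irreflexive cadj.
Proof. by move=> u; rewrite /cadj eqxx. Qed.

Fact cadj_sym : symmetric cadj.
Proof. by move=> u v; rewrite /cadj eq_sym common_outC. Qed.

Fact cwt_sym u v : cwt u v = cwt v u.
Proof. by rewrite /cwt common_outC. Qed.

Definition competition_graph : wgraph 'I_n := WGraph cadj_irr cadj_sym cwt_sym.

End Competition.

Section StarIsolated.
Variables m k : nat.

(* Vertices of K_{1,m} plus k isolated vertices: inl None is the centre,
   inl (Some i) the leaves, inr j the isolated vertices. *)
Definition sadj : rel (option 'I_m + 'I_k)%type := fun x y =>
  match x, y with
  | inl None, inl (Some _) | inl (Some _), inl None => true
  | _, _ => false
  end.

Fact sadj_irr : irreflexive sadj.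
Proof. by case=> [[]|]. Qed.

Fact sadj_sym : symmetric sadj.
Proof. by do 2!case=> [[?|]|?]. Qed.

Definition star_isolated : wgraph (option 'I_m + 'I_k)%type :=
  @WGraph _ sadj (fun _ _ => 1) sadj_irr sadj_sym (fun _ _ => erefl).

End StarIsolated.

(* An isomorphism forces m + 1 + k = n, so bounding k by n loses nothing. *)
Definition Winv_star132 (n m : nat) : {set 'S_n} :=
  [set p : 'S_n | avoids132 p &&
     [exists k : 'I_n.+1, wgiso (competition_graph p) (star_isolated m k)]].

Definition h (m n : nat) : nat := #|Winv_star132 n m|.

(* Main.v *)
Require Import Defs.
From mathcomp Require Import all_boot all_fingroup.
From mathcomp Require Import zify.

(* Cut a 132-avoiding permutation at its maximum N, as L N R.  Every entry of L
   exceeds every entry of R, so no competition edge joins L or N to R, the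
   out-neighbours of N are exactly the entries of L, and the weight between N
   and an entry of L is the out-degree of that entry.  For m > 0 the graph is
   therefore K_{1,m} plus isolated vertices iff either L is decreasing and R is
   of that kind, or R is edgeless and L is edgeless with all out-degrees at most
   1, exactly m of them equal to 1 (N is then a centre).  Let f m k count the
   words L of the latter kind: cutting L at its own maximum leaves at most one
   entry to the left of it, so f (m+1) (k+2) = f (m+1) (k+1) + f m k.  With e
   counting the edgeless permutations,
     h m (n+1) = \sum_(k <= n) h m k + \sum_(k <= n) f m k * e (n - k),
   and the recurrence for f passes to h by strong induction on n, whatever e
   is. *)

Set Implicit Arguments.
Unset Strict Implicit.
Unset Printing Implicit Defensive.

(** * Quantifiers and counts over initial segments *)

Lemma all_iotaP (n : nat) (P : pred nat) :
  reflect (forall i, i < n -> P i) (all P (iota 0 n)).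
Proof.
by apply: (iffP allP) => H i; have := H i; rewrite mem_iota add0n.
Qed.

(** The index range is cut into a left block, the position [k] of the maximum and a right block
    re-indexed from 0; likewise for [has] and [count] below. *)
Lemma all_iota_glue (k l : nat) (P : pred nat) :
  all P (iota 0 (k + l).+1) =
  [&& all P (iota 0 k), P k & all (fun x => P (k.+1 + x)) (iota 0 l)].
Proof.
by rewrite -addnS iotaD all_cat /= add0n -[in iota k.+1 l](addn0 k.+1) iotaDl all_map.
Qed.

Lemma has_iota_glue (k l : nat) (P : pred nat) :
  has P (iota 0 (k + l).+1) =
  [|| has P (iota 0 k), P k | has (fun x => P (k.+1 + x)) (iota 0 l)].
Proof.
by rewrite -addnS iotaD has_cat /= add0n -[in iota k.+1 l](addn0 k.+1) iotaDl has_map.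
Qed.

Lemma count_iota_glue (k l : nat) (P : pred nat) :
  count P (iota 0 (k + l).+1) =
  count P (iota 0 k) + (P k + count (fun x => P (k.+1 + x)) (iota 0 l)).
Proof.
by rewrite -addnS iotaD count_cat /= add0n -[in iota k.+1 l](addn0 k.+1) iotaDl count_map.
Qed.

Lemma count_iota0 (n : nat) (P : pred nat) :
  (forall i, i < n -> P i = false) -> count P (iota 0 n) = 0.
Proof.
move=> H; apply/eqP; rewrite eqn0Ngt -has_count; apply/hasPn => i.
by rewrite mem_iota => /H ->.
Qed.

Lemma eq_count_iota (n : nat) (P Q : pred nat) :
  (forall i, i < n -> P i = Q i) -> count P (iota 0 n) = count Q (iota 0 n).
Proof. by move=> H; apply: eq_in_count => i; rewrite mem_iota; apply: H. Qed.

Lemma eq_all_iota (n : nat) (P Q : pred nat) :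
  (forall i, i < n -> P i = Q i) -> all P (iota 0 n) = all Q (iota 0 n).
Proof. by move=> H; apply: eq_in_all => i; rewrite mem_iota; apply: H. Qed.

Lemma eq_has_iota (n : nat) (P Q : pred nat) :
  (forall i, i < n -> P i = Q i) -> has P (iota 0 n) = has Q (iota 0 n).
Proof. by move=> H; apply: eq_in_has => i; rewrite mem_iota; apply: H. Qed.

(** * Competition graphs of words *)

Section WordGraph.
Variables (n : nat) (q : nat -> nat).

Definition narc (u x : nat) : bool := (x < u) && (q x < q u).

(* On the diagonal, [ncom u u] is the out-degree of [u]. *)
Definition ncom (u v : nat) : nat :=
  count (fun x => narc u x && narc v x) (iota 0 n).

Definition avoids : Prop :=
  forall i j k, i < j -> j < k -> k < n -> q i < q k -> q k < q j -> False.

Definition arcless : bool := all (fun u => ncom u u == 0) (iota 0 n).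

Definition edgeless : bool :=
  all (fun u => all (fun v => (u != v) ==> (ncom u v == 0)) (iota 0 n))
    (iota 0 n).

(** Arcs compose, so out-degrees at most 1 exclude paths of length 2, and [edgeless] excludes shared
    targets: the arcs are [m] pairwise disjoint ones. *)
Definition matching (m : nat) : bool :=
  [&& edgeless, all (fun u => ncom u u <= 1) (iota 0 n)
    & count (fun u => 0 < ncom u u) (iota 0 n) == m].

Definition star_at (m c : nat) : bool :=
  [&& all (fun u => (u != c) ==> (ncom u c <= 1)) (iota 0 n),
      all (fun u => (u != c) ==>
        all (fun v => [&& v != c & u != v] ==> (ncom u v == 0)) (iota 0 n))
        (iota 0 n)
    & count (fun u => (u != c) && (0 < ncom u c)) (iota 0 n) == m].

(** The centre is existential because it can fail to be unique: for [m = 1] both ends of the edge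
    qualify. *)
Definition star (m : nat) : bool := has (star_at m) (iota 0 n).

Lemma ncomC (u v : nat) : ncom u v = ncom v u.
Proof. by apply: eq_count => x; rewrite andbC. Qed.

Lemma ncom_le (u v : nat) : ncom u v <= ncom u u.
Proof. by apply: sub_count => x /andP[->]. Qed.

Lemma ncom_ler (u v : nat) : ncom u v <= ncom v v.
Proof. by rewrite ncomC ncom_le. Qed.

End WordGraph.

Lemma edgelessP n q :
  reflect (forall u v, u < n -> v < n -> u != v -> ncom n q u v = 0)
    (edgeless n q).
Proof.
apply: (iffP (all_iotaP _ _)) => [H u v un vn uv|H u un].
  by have /all_iotaP/(_ v vn)/implyP/(_ uv)/eqP := H u un.
by apply/all_iotaP => v vn; apply/implyP => uv; rewrite H.
Qed.

Lemma arclessP n q :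
  reflect (forall u, u < n -> ncom n q u u = 0) (arcless n q).
Proof. by apply: (iffP (all_iotaP _ _)) => H u un; apply/eqP; rewrite H. Qed.

Lemma matchingP n q m :
  reflect [/\ forall u v, u < n -> v < n -> u != v -> ncom n q u v = 0,
              forall u, u < n -> ncom n q u u <= 1
            & count (fun u => 0 < ncom n q u u) (iota 0 n) = m]
    (matching n q m).
Proof.
by apply: (iffP and3P) => -[/edgelessP H1 /all_iotaP H2 /eqP H3].
Qed.

Lemma star_atP n q m c :
  reflect [/\ forall u, u < n -> u != c -> ncom n q u c <= 1,
              forall u v, u < n -> v < n -> u != c -> v != c -> u != v ->
                ncom n q u v = 0
            & count (fun u => (u != c) && (0 < ncom n q u c)) (iota 0 n) = m]
    (star_at n q m c).
Proof.
apply: (iffP and3P) => -[H1 H2 /eqP H3]; split=> //.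
- by move=> u un uc; have /all_iotaP/(_ u un)/implyP/(_ uc) := H1.
- move=> u v un vn uc vc uv.
  have /all_iotaP/(_ u un)/implyP/(_ uc)/all_iotaP/(_ v vn) := H2.
  by rewrite vc uv => /eqP.
- by apply/all_iotaP => u un; apply/implyP; apply: H1.
- apply/all_iotaP => u un; apply/implyP => uc; apply/all_iotaP => v vn.
  by apply/implyP => /andP[vc uv]; rewrite H2.
Qed.

Lemma arcless_small n q : n <= 1 -> arcless n q.
Proof.
move=> n1; apply/arclessP => u un; apply: count_iota0 => x _.
by rewrite /narc; apply/negbTE; lia.
Qed.

Lemma arcless_matching k q m : 0 < m -> arcless k q -> matching k q m = false.
Proof.
move=> m0 /arclessP H; apply/negP => /and3P[_ _].
by rewrite count_iota0 => [/eqP m_0|u /H -> //]; rewrite -m_0 in m0.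
Qed.

(** * Cutting a word at its maximum *)

Section Glue.
Variables (k l : nat) (q1 q2 q : nat -> nat).

Definition glued : Prop :=
  [/\ forall x, x < k -> q x = l + q1 x, q k = k + l
    & forall x, x < l -> q (k.+1 + x) = q2 x].

Hypothesis q1k : forall x, x < k -> q1 x < k.
Hypothesis q2l : forall x, x < l -> q2 x < l.
Hypothesis qG : glued.

Let n := (k + l).+1.

(** A pattern within one block is excluded by hypothesis. If it ends on the right but starts at or
    before the maximum, its first entry is too large; if it ends at the maximum, its middle entry
    cannot be larger. *)
Lemma avoids_glue : avoids k q1 -> avoids l q2 -> avoids n q.
Proof.
case: qG => G1 Gk G2 A1 A2 i j h ij jh hn.
case: (ltngtP h k) => hk.
- rewrite !G1; try lia; rewrite !ltn_add2l; apply: A1 => //.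
- case: (ltngtP i k) => ik.
  + have -> : h = k.+1 + (h - k.+1) by lia.
    rewrite (G1 i) // (G2 (h - k.+1)); last by lia.
    have := q2l (x := h - k.+1); lia.
  + have -> : h = k.+1 + (h - k.+1) by lia.
    have -> : i = k.+1 + (i - k.+1) by lia.
    have -> : j = k.+1 + (j - k.+1) by lia.
    rewrite !G2; try lia; apply: A2; lia.
  + rewrite ik Gk.
    have -> : h = k.+1 + (h - k.+1) by lia.
    rewrite (G2 (h - k.+1)); last by lia.
    have := q2l (x := h - k.+1); lia.
- subst h; rewrite Gk (G1 j) //; have := q1k jh; lia.
Qed.

(** * Arcs and common out-neighbours of a glued word *)

Lemma narc_left u x : u < k -> x < k -> narc q u x = narc q1 u x.
Proof. by case: qG => G1 _ _ uk xk; rewrite /narc !G1 // ltn_add2l. Qed.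

Lemma narc_left0 u x : u <= k -> k <= x -> narc q u x = false.
Proof. by move=> uk xk; rewrite /narc ltnNge (leq_trans uk xk). Qed.

Lemma narc_mid x : x < k -> narc q k x.
Proof. case: qG => G1 Gk _ xk; rewrite /narc xk Gk G1 //; have := q1k xk; lia. Qed.

Lemma narc_right u x : u < l -> x < l -> narc q (k.+1 + u) (k.+1 + x) = narc q2 u x.
Proof. by case: qG => _ _ G2 ul xl; rewrite /narc !G2 // ltn_add2l. Qed.

Lemma narc_right0 u x : u < l -> x <= k -> narc q (k.+1 + u) x = false.
Proof.
case: qG => G1 Gk G2 ul; rewrite leq_eqVlt /narc G2 // => /orP[/eqP->|xk].
  rewrite Gk; have := q2l ul; lia.
rewrite G1 //; have := q2l ul; lia.
Qed.

Lemma ncom_left u v : u < k -> v < k -> ncom n q u v = ncom k q1 u v.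
Proof.
move=> uk vk; rewrite /ncom count_iota_glue narc_left0 ?(ltnW uk) //=.
rewrite (count_iota0 (n := l)) => [|x _]; last by rewrite narc_left0; lia.
by rewrite !addn0; apply: eq_count_iota => x xk; rewrite !narc_left.
Qed.

Lemma ncom_mid u : u < k -> ncom n q u k = ncom k q1 u u.
Proof.
move=> uk; rewrite /ncom count_iota_glue narc_left0 ?(ltnW uk) //=.
rewrite (count_iota0 (n := l)) => [|x _]; last by rewrite narc_left0; lia.
rewrite !addn0; apply: eq_count_iota => x xk; rewrite narc_left // narc_mid //.
by rewrite andbb andbT.
Qed.

Lemma ncom_midmid : ncom n q k k = k.
Proof.
rewrite /ncom count_iota_glue narc_left0 //=.
rewrite (count_iota0 (n := l)) => [|x _]; last by rewrite narc_left0; lia.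
rewrite !addn0 (eq_count_iota (Q := predT)) => [|x xk]; last by rewrite narc_mid.
by rewrite count_predT size_iota.
Qed.

Lemma ncom_cross u v : u <= k -> v < l -> ncom n q u (k.+1 + v) = 0.
Proof.
move=> uk vl; rewrite /ncom count_iota_glue narc_left0 //=.
rewrite !count_iota0 // => x xk; first by rewrite narc_left0; lia.
by rewrite narc_right0 ?andbF //; lia.
Qed.

Lemma ncom_right u v : u < l -> v < l ->
  ncom n q (k.+1 + u) (k.+1 + v) = ncom l q2 u v.
Proof.
move=> ul vl; rewrite /ncom count_iota_glue narc_right0 //=.
rewrite (count_iota0 (n := k)) => [|x xk]; last by rewrite narc_right0 //; lia.
by rewrite !add0n; apply: eq_count_iota => x xl; rewrite !narc_right.
Qed.

(** * Graph properties of a glued word *)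

Lemma arcless_glue : arcless n q = (k == 0) && arcless l q2.
Proof.
(* The maximum has out-degree [k], which has to vanish. *)
rewrite /arcless all_iota_glue ncom_midmid.
case: eqP => [k0|_] /=; last by rewrite andbF.
rewrite (_ : all _ (iota 0 k)); last by rewrite k0.
by apply: eq_all_iota => u ul; rewrite ncom_right.
Qed.

Lemma forall_glue (P : nat -> Prop) :
  (forall u, u < k -> P u) -> P k -> (forall u, u < l -> P (k.+1 + u)) ->
  forall u, u < n -> P u.
Proof.
move=> P1 Pk P2 u un; case: (ltngtP u k) => [/P1 //|uk|-> //].
have -> : u = k.+1 + (u - k.+1) by lia.
by apply: P2; rewrite /n in un; lia.
Qed.

(** An entry on the left shares all its out-neighbours with the maximum, so it may have none; this
    is why the left factor is [arcless]. *)
Lemma edgeless_glue : edgeless n q = arcless k q1 && edgeless l q2.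
Proof.
apply/edgelessP/andP => [H|[/arclessP H1 /edgelessP H2]].
  split; [apply/arclessP => u uk|apply/edgelessP => u v ul vl uv].
    by rewrite -ncom_mid // H /n; lia.
  by rewrite -ncom_right // H /n; lia.
have H1' u v : u < k -> v < k -> ncom k q1 u v = 0.
  by move=> uk _; have := ncom_le k q1 u v; rewrite H1 // leqn0 => /eqP.
move=> u v un vn; move: v vn u un.
apply: forall_glue => [v vk||v vl]; apply: forall_glue => [u uk||u ul] uv.
- by rewrite ncom_left // H1'.
- by rewrite ncomC ncom_mid // H1.
- by rewrite ncomC ncom_cross // ltnW.
- by rewrite ncom_mid // H1.
- by rewrite eqxx in uv.
- by rewrite ncomC ncom_cross.
- by rewrite ncom_cross // ltnW.
- by rewrite ncom_cross.
- by rewrite ncom_right // H2 //; lia.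
Qed.

(** The maximum has out-degree [k], so [k <= 1]. For [k = 1] it carries one of the [m] arcs, whence
    [m.-1]; the guard [0 < m] is there because [0.-1 = 0]. *)
Lemma matching_glue m :
  matching n q m =
  (k == 0) && matching l q2 m || [&& k == 1, 0 < m & matching l q2 m.-1].
Proof.
rewrite /matching edgeless_glue all_iota_glue count_iota_glue ncom_midmid.
rewrite (eq_all_iota (n := l) (Q := fun u => ncom l q2 u u <= 1)); last first.
  by move=> u ul; rewrite ncom_right.
rewrite (eq_count_iota (n := l) (Q := fun u => 0 < ncom l q2 u u)); last first.
  by move=> u ul; rewrite ncom_right.
case A: (arcless k q1); last first.
  (* A left block that is not arcless has length at least 2, so both sides are false. *)
  by case: (leqP k 1) => [/(arcless_small q1)|]; [rewrite A|case: (k) => [|[|?]]].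
have {}A := arclessP _ _ A; rewrite (_ : all _ (iota 0 k)); last first.
  by apply/all_iotaP => u uk; rewrite ncom_left // A.
rewrite count_iota0 => [|u uk]; last by rewrite ncom_left // A.
case: (edgeless l q2) => //=; last by rewrite !andbF.
case: (all _ _) => /=; last by rewrite !andbF.
by lia.
Qed.

(** The maximum and a left entry are then both different from the centre, so they must not be
    adjacent, and their weight is the out-degree of that entry. *)
Lemma star_at_right m c : c < l ->
  star_at n q m (k.+1 + c) = arcless k q1 && star_at l q2 m c.
Proof.
move=> cl; have kn u : u <= k -> (u < n) && (u != k.+1 + c) by rewrite /n; lia.
have cnt : count (fun u => (u != k.+1 + c) && (0 < ncom n q u (k.+1 + c)))
             (iota 0 n) =
           count (fun u => (u != c) && (0 < ncom l q2 u c)) (iota 0 l).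
  rewrite count_iota_glue ncom_cross // andbF.
  rewrite count_iota0 => [|u uk]; last by rewrite ncom_cross ?andbF // ltnW.
  by rewrite !add0n; apply: eq_count_iota => u ul; rewrite ncom_right // eqn_add2l.
apply/star_atP/andP; rewrite cnt.
  case=> H1 H2 H3; split.
    apply/arclessP => u uk; rewrite -ncom_mid //.
    by have := kn u (ltnW uk); have := kn k (leqnn k); case/andP=> ? ? /andP[??];
       apply: H2 => //; rewrite neq_ltn uk.
  apply/star_atP; split=> //.
    by move=> u ul uc; rewrite -ncom_right //; apply: H1; rewrite /n; lia.
  by move=> u v ul vl uc vc uv; rewrite -ncom_right //; apply: H2; rewrite /n; lia.
case=> /arclessP H0 /star_atP[H1 H2 H3].
have H0' u v : u < k -> v < k -> ncom k q1 u v = 0.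
  by move=> uk _; have := ncom_le k q1 u v; rewrite H0 // leqn0 => /eqP.
split=> //.
  apply: forall_glue => [u uk||u ul] uc.
  - by rewrite ncom_cross // ltnW.
  - by rewrite ncom_cross.
  - by rewrite ncom_right // H1 //; lia.
move=> u v un vn; move: v vn u un.
apply: forall_glue => [v vk||v vl]; apply: forall_glue => [u uk||u ul] uc vc uv.
- by rewrite ncom_left // H0'.
- by rewrite ncomC ncom_mid // H0.
- by rewrite ncomC ncom_cross // ltnW.
- by rewrite ncom_mid // H0.
- by rewrite eqxx in uv.
- by rewrite ncomC ncom_cross.
- by rewrite ncom_cross // ltnW.
- by rewrite ncom_cross.
- by rewrite ncom_right // H2 //; lia.
Qed.

(** Weights at the maximum are out-degrees on the left, so the leaves are the left entries of
    out-degree 1, and the conditions of [star_at] on the left block become those of [matching]. *)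
Lemma star_at_mid m : star_at n q m k = matching k q1 m && edgeless l q2.
Proof.
have cnt : count (fun u => (u != k) && (0 < ncom n q u k)) (iota 0 n) =
           count (fun u => 0 < ncom k q1 u u) (iota 0 k).
  rewrite count_iota_glue eqxx (count_iota0 (n := l)) => [|u ul]; last first.
    by rewrite ncomC ncom_cross ?andbF.
  by rewrite !addn0; apply: eq_count_iota => u uk; rewrite ncom_mid // neq_ltn uk.
apply/star_atP/andP; rewrite cnt.
  case=> H1 H2 H3; split.
    apply/matchingP; split=> // [u v uk vk uv|u uk].
      by rewrite -ncom_left //; apply: H2; rewrite /n; lia.
    by rewrite -ncom_mid //; apply: H1; rewrite /n; lia.
  by apply/edgelessP => u v ul vl uv; rewrite -ncom_right //; apply: H2; rewrite /n; lia.
case=> /matchingP[H1 H2 H3] /edgelessP H4; split=> //.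
  apply: forall_glue => [u uk||u ul] uc.
  - by rewrite ncom_mid // H2.
  - by rewrite eqxx in uc.
  - by rewrite ncomC ncom_cross.
move=> u v un vn; move: v vn u un.
apply: forall_glue => [v vk||v vl]; apply: forall_glue => [u uk||u ul] uc vc uv.
- by rewrite ncom_left // H1.
- by rewrite eqxx in uc.
- by rewrite ncomC ncom_cross // ltnW.
- by rewrite eqxx in vc.
- by rewrite eqxx in uv.
- by rewrite eqxx in vc.
- by rewrite ncom_cross // ltnW.
- by rewrite ncom_cross.
- by rewrite ncom_right // H4 //; lia.
Qed.

(* A centre to the left of the maximum has the maximum as its only neighbour,
   so the star is a single edge and the maximum is a centre as well. *)
Lemma star_at_left m c : 0 < m -> c < k -> star_at n q m c ->
  matching k q1 m && edgeless l q2.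
Proof.
move=> m0 ck /star_atP[H1 H2 H3].
have Hr : edgeless l q2.
  by apply/edgelessP => u v ul vl uv; rewrite -ncom_right //; apply: H2; rewrite /n; lia.
(* Neither [u] nor the maximum is [c], so they are not adjacent; their weight is the out-degree of
   [u]. *)
have H0 u : u < k -> u != c -> ncom k q1 u u = 0.
  by move=> uk uc; rewrite -ncom_mid //; apply: H2; rewrite /n; lia.
have Hc : ncom k q1 c c <= 1.
  by rewrite -ncom_mid // ncomC; apply: H1; rewrite /n; lia.
rewrite Hr andbT; apply/matchingP; split.
- move=> u v uk vk uv; have := ncom_le k q1 u v; have := ncom_ler k q1 u v.
  by case: (eqVneq u c) => [uc|/(H0 _ uk)->]; [rewrite (H0 v) //; lia|lia].
- by move=> u uk; case: (eqVneq u c) => [->//|/(H0 _ uk)->].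
(* Both counts are 1 or 0 according to whether [c] has an arc: on the left only [c] can have one,
   and only the maximum can be adjacent to [c]. *)
rewrite -H3 count_iota_glue ncomC ncom_mid //.
rewrite [in RHS](count_iota0 (n := k)) => [|u uk]; last first.
  rewrite ncom_left //; have := ncom_le k q1 u c.
  by case: eqVneq => [//|/(H0 _ uk)->] /=; lia.
rewrite (count_iota0 (n := l)) => [|u ul]; last first.
  by rewrite ncomC ncom_cross ?andbF // ltnW.
rewrite add0n !addn0 neq_ltn ck orbT /=.
rewrite (eq_count_iota (Q := fun u => (u == c) && (0 < ncom k q1 c c))); last first.
  by move=> u uk; case: eqVneq => [->//|/(H0 _ uk)->].
case: (0 < _) => /=; last by rewrite count_iota0 // => u _; rewrite andbF.
rewrite (eq_count (a2 := pred1 c)) => [|u /=]; last by rewrite andbT.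
by rewrite count_uniq_mem ?iota_uniq // mem_iota ck.
Qed.

Lemma star_glue m : 0 < m ->
  star n q m = arcless k q1 && star l q2 m || matching k q1 m && edgeless l q2.
Proof.
move=> m0; rewrite /star has_iota_glue star_at_mid.
rewrite (eq_has_iota (n := l) (Q := fun c => arcless k q1 && star_at l q2 m c)); last first.
  by move=> c; apply: star_at_right.
have -> : has (fun c => arcless k q1 && star_at l q2 m c) (iota 0 l) =
          arcless k q1 && has (star_at l q2 m) (iota 0 l).
  by case: (arcless k q1); rewrite //= has_pred0.
(* A centre on the left already yields the second alternative. *)
case Hl: (has _ (iota 0 k)); last by rewrite orFb orbC.
have /hasP[c] := Hl; rewrite mem_iota /= => ck /(star_at_left m0 ck) ->.
by rewrite orbT.
Qed.

End Glue.

(** * Permutations as words *)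

(* One-line notation as a function on [nat], with value 0 outside [0, n). *)
Definition pfun n (p : 'S_n) (i : nat) : nat :=
  oapp (fun j : 'I_n => val (p j)) 0 (insub i).

Lemma pfunE n (p : 'S_n) (i : 'I_n) : pfun p i = p i.
Proof. by rewrite /pfun valK. Qed.

Lemma pfun_lt n (p : 'S_n) i : i < n -> pfun p i < n.
Proof. by move=> ilt; rewrite (pfunE p (Ordinal ilt)). Qed.

Lemma pfun_inj n (p : 'S_n) i j : i < n -> j < n -> pfun p i = pfun p j -> i = j.
Proof.
move=> ilt jlt; rewrite (pfunE p (Ordinal ilt)) (pfunE p (Ordinal jlt)).
by move/val_inj/perm_inj/(congr1 val).
Qed.

Lemma eq_pfun n (p p' : 'S_n) : (forall i, i < n -> pfun p i = pfun p' i) -> p = p'.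
Proof.
by move=> H; apply/permP => i; apply: val_inj; rewrite /= -!pfunE H.
Qed.

Lemma avoids132P n (p : 'S_n) : reflect (avoids n (pfun p)) (avoids132 p).
Proof.
apply: (iffP idP) => [H i j k ij jk kn ik kj|H].
  have jn := ltn_trans jk kn; have iltn := ltn_trans ij jn.
  move: H => /forallP/(_ (Ordinal iltn))/forallP/(_ (Ordinal jn)).
  by move=> /forallP/(_ (Ordinal kn))/negP[]; rewrite -!pfunE /= ij jk ik kj.
apply/forallP => i; apply/forallP => j; apply/forallP => k; apply/negP.
by case/and4P; rewrite -!pfunE => ij jk; apply: (H i j k).
Qed.

(* The identity when [f] does not restrict to a permutation of [0, n). *)
Definition fperm n (f : nat -> nat) : 'S_n :=
  odflt 1%g [pick p : 'S_n | [forall i : 'I_n, p i == f i :> nat]].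

Lemma fpermE n f : (forall i, i < n -> f i < n) ->
  (forall i j, i < n -> j < n -> f i = f j -> i = j) ->
  forall i, i < n -> pfun (fperm n f) i = f i.
Proof.
move=> fn finj i ilt; rewrite /fperm; case: pickP => [p /forallP H|H] /=.
  by rewrite (pfunE p (Ordinal ilt)) (eqP (H (Ordinal ilt))).
pose g (j : 'I_n) := Ordinal (fn j (ltn_ord j)).
have ginj : injective g.
  by move=> a b /(congr1 val) /= /(finj _ _ (ltn_ord a) (ltn_ord b)); apply: val_inj.
have : [forall j : 'I_n, perm ginj j == f j :> nat].
  by apply/forallP => j; rewrite permE.
by rewrite H.
Qed.

Lemma pigeonhole_iota l v f : (forall x, x < l -> f x < v) ->
  (forall x y, x < l -> y < l -> f x = f y -> x = y) -> l <= v.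
Proof.
move=> flt finj; rewrite -(size_iota 0 l) -(size_map f) -(size_iota 0 v).
apply: uniq_leq_size => [|y /mapP[x]]; last first.
  by rewrite mem_iota => /= xl ->; rewrite mem_iota; apply: flt.
rewrite map_inj_in_uniq ?iota_uniq // => x y; rewrite !mem_iota /=.
exact: finj.
Qed.

(** * Gluing and cutting permutations *)

Section PermGlue.
Variables k l : nat.

Definition pglue (st : 'S_k * 'S_l) : 'S_(k + l).+1 :=
  fperm (k + l).+1 (fun i => if i < k then l + pfun st.1 i
    else if i == k then k + l else pfun st.2 (i - k.+1)).

Lemma pglueP st : glued k l (pfun st.1) (pfun st.2) (pfun (pglue st)).
Proof.
have E i : i < (k + l).+1 -> pfun (pglue st) i =
    if i < k then l + pfun st.1 i
    else if i == k then k + l else pfun st.2 (i - k.+1).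
  apply: fpermE => {i} [i ilt|i j ilt jlt].
    case: (ltngtP i k) => // ik; first by have := pfun_lt st.1 ik; lia.
    have il : i - k.+1 < l by lia.
    by have := pfun_lt st.2 il; lia.
  have B1 := pfun_lt st.1; have B2 := pfun_lt st.2.
  have L1 := @pfun_inj _ st.1; have L2 := @pfun_inj _ st.2.
  case: (ltngtP i k) => ik; case: (ltngtP j k) => jk; subst=> //.
  - by move/addnI/(L1 _ _ ik jk).
  - by have := B2 (j - k.+1); lia.
  - by have := B1 _ ik; lia.
  - by have := B2 (i - k.+1); lia.
  - by move/(L2 (i - k.+1) (j - k.+1)); lia.
  - by have := B2 (i - k.+1); lia.
  - by have := B1 _ jk; lia.
  - by have := B2 (j - k.+1); lia.
split=> [x xk||x xl]; rewrite E; try lia.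
- by rewrite xk.
- by rewrite ltnn eqxx.
- by rewrite ltnNge ltnW ?leq_addr //= gtn_eqF ?leq_addr // addKn.
Qed.

(* Across the maximum, avoiding 132 forces every entry on the left to exceed
   every entry on the right; pigeonhole then fixes the two sets of values. *)
Lemma unglue (p : 'S_(k + l).+1) : avoids132 p -> pfun p k = k + l ->
  exists2 st : 'S_k * 'S_l, avoids132 st.1 && avoids132 st.2
            & glued k l (pfun st.1) (pfun st.2) (pfun p).
Proof.
move=> /avoids132P av pk; pose n := (k + l).+1; have B := @pfun_lt _ p.
have I := @pfun_inj _ p.
have kn : k < n by rewrite /n; lia.
have nk i : i < n -> i != k -> pfun p i < k + l.
  move=> ilt /eqP ik; have := B _ ilt.
  by have := I _ _ ilt kn; lia.
(* Otherwise positions [i], [k] and [k.+1 + j] form the pattern 132. *)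
have cross i j : i < k -> j < l -> pfun p (k.+1 + j) < pfun p i.
  move=> ik jl; have jn : k.+1 + j < n by rewrite /n; lia.
  have iltn : i < n by rewrite /n; lia.
  case: ltngtP => // [lt|/(I _ _ jn iltn)]; last by lia.
  case: (av i k (k.+1 + j)) => //; first by lia.
  by rewrite pk; apply: nk => //; lia.
(* The [l] distinct values on the right all lie below [pfun p i]. *)
have Lge i : i < k -> l <= pfun p i.
  move=> ik; apply: (@pigeonhole_iota _ _ (fun x => pfun p (k.+1 + x))).
    by move=> x; apply: cross.
  by move=> x y xl yl h; apply/(@addnI k.+1)/I => //; lia.
have Rlt j : j < l -> pfun p (k.+1 + j) < l.
  move=> jl; set w := pfun p _.
  have wlt : w < k + l by apply: nk; rewrite /n; lia.
  have wk x : x <= k -> w < pfun p x.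
    by rewrite leq_eqVlt => /orP[/eqP->|/cross]; [rewrite pk|apply].
  (* The [k.+1] distinct values at positions up to [k] all lie above [w] and are at most [k + l];
     hence [w < l]. *)
  have : k.+1 <= k + l - w.
    apply: (@pigeonhole_iota _ _ (fun x => pfun p x - w.+1)).
      by move=> x xk; have := wk x xk; have := B x; lia.
    move=> x y xk yk; have := wk x xk; have := wk y yk; move=> h1 h2 h.
    by apply: I; lia.
  by lia.
have E1 : forall i, i < k ->
    pfun (fperm k (fun i => pfun p i - l)) i = pfun p i - l.
  apply: fpermE => [i ik|i j ik jk].
    by have := Lge _ ik; have := nk i; lia.
  by have := Lge _ ik; have := Lge _ jk; move=> h1 h2 h; apply: I; lia.
have E2 : forall i, i < l ->
    pfun (fperm l (fun i => pfun p (k.+1 + i))) i = pfun p (k.+1 + i).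
  apply: fpermE => [i il|i j il jl]; first exact: Rlt.
  by move=> h; apply/(@addnI k.+1)/I => //; lia.
exists (fperm k (fun i => pfun p i - l), fperm l (fun i => pfun p (k.+1 + i))) => /=.
  apply/andP; split; apply/avoids132P => a b c ab bc cn.
    rewrite !E1; try lia; move=> h1 h2; apply: (av a b c) => //; first by lia.
      by lia.
    by lia.
  rewrite !E2; try lia.
  by apply: av; lia.
split=> // [x xk|x xl]; first by rewrite E1 // subnKC // Lge.
by rewrite E2.
Qed.

Lemma glued_inj (st st' : 'S_k * 'S_l) q :
  glued k l (pfun st.1) (pfun st.2) q -> glued k l (pfun st'.1) (pfun st'.2) q ->
  st = st'.
Proof.
case: st st' => [s t] [s' t'] [H1 _ H2] [H1' _ H2']; congr (_, _); apply: eq_pfun => i ilt.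
  by apply: (@addnI l); rewrite -H1 // -H1'.
by rewrite -H2 // -H2'.
Qed.

Lemma eq_glued (st : 'S_k * 'S_l) (p p' : 'S_(k + l).+1) :
  glued k l (pfun st.1) (pfun st.2) (pfun p) ->
  glued k l (pfun st.1) (pfun st.2) (pfun p') -> p = p'.
Proof.
case=> H1 Hk H2 [H1' Hk' H2']; apply: eq_pfun; apply: forall_glue => [u uk||u ul].
- by rewrite H1 ?H1'.
- by rewrite Hk.
- by rewrite H2 ?H2'.
Qed.

End PermGlue.

(** * Counting *)

(** [P] takes the length along with the word, so that the same property can be asked of a word and
    of the blocks of its cut. *)
Definition avoiders (P : nat -> (nat -> nat) -> bool) n : {set 'S_n} :=
  [set p | avoids132 p && P n (pfun p)].

Definition card_avoiders P n : nat := #|avoiders P n|.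

Section Count.
Variables P A1 B1 A2 B2 : nat -> (nat -> nat) -> bool.
Hypothesis P_glue : forall k l q1 q2 q, (forall x, x < k -> q1 x < k) ->
  (forall x, x < l -> q2 x < l) -> glued k l q1 q2 q ->
  P (k + l).+1 q = A1 k q1 && B1 l q2 || A2 k q1 && B2 l q2.
Hypothesis A_disj : forall k q, A1 k q -> A2 k q = false.

(** Gluing maps the pairs in [X1 :|: X2] bijectively onto these permutations: [unglue] gives
    surjectivity, [glued_inj] injectivity. By [A_disj] the two products are disjoint, so their sizes
    add. *)
Lemma card_avoiders_max n k l : n = (k + l).+1 ->
  #|[set p in avoiders P n | pfun p k == k + l]| =
  card_avoiders A1 k * card_avoiders B1 l + card_avoiders A2 k * card_avoiders B2 l.
Proof.
move=> ->; rewrite -!cardsX.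
set X1 := setX _ _; set X2 := setX _ _.
have -> : [set p in avoiders P (k + l).+1 | pfun p k == k + l] =
          @pglue k l @: (X1 :|: X2).
  apply/setP => p; rewrite !inE; apply/andP/imsetP.
    case=> /andP[av Pp] /eqP pk; have [st /andP[av1 av2] G] := unglue av pk.
    exists st; last exact: eq_glued G (pglueP st).
    rewrite (P_glue _ _ G) in Pp; try exact: pfun_lt.
    by rewrite !inE av1 av2.
  case=> st; rewrite !inE => Hst ->; have G := pglueP st.
  have [_ pk _] := G; rewrite pk eqxx; split=> //.
  rewrite (P_glue _ _ G); try exact: pfun_lt.
  have /andP[av1 av2] : avoids132 st.1 && avoids132 st.2.
    by case/orP: Hst => /andP[/andP[-> _] /andP[-> _]].
  rewrite av1 av2 /= in Hst; rewrite Hst andbT; apply/avoids132P.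
  by apply: avoids_glue G _ _; try exact: pfun_lt; apply/avoids132P.
rewrite card_in_imset => [|st st' _ _ e]; last first.
  by apply: glued_inj (pglueP st) _; rewrite e; apply: pglueP.
rewrite cardsU (_ : X1 :&: X2 = set0) ?cards0 ?subn0 //.
apply/setP => st; rewrite !inE; apply/negP.
by case/andP=> /andP[/andP[_ /A_disj H] _] /andP[/andP[_]]; rewrite H.
Qed.

Lemma card_avoidersS n :
  card_avoiders P n.+1 =
  \sum_(k < n.+1) (card_avoiders A1 k * card_avoiders B1 (n - k) +
                   card_avoiders A2 k * card_avoiders B2 (n - k)).
Proof.
rewrite /card_avoiders -sum1_card.
(* The permutations are sorted by the position of their maximum. *)
rewrite (partition_big (fun p : 'S_n.+1 => (p^-1)%g ord_max) predT) //=.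
apply: eq_bigr => k _; have kn : k <= n by rewrite -ltnS.
rewrite -(@card_avoiders_max n.+1); last by rewrite subnKC.
rewrite -sum1_card; apply: eq_bigl => p; rewrite !inE; congr (_ && _).
rewrite subnKC // pfunE; apply/eqP/eqP => [<-|pk]; first by rewrite permKV.
by apply: (@perm_inj _ p); rewrite permKV; apply: val_inj.
Qed.

End Count.

(** * Recurrences for the individual classes *)

Lemma card_avoiders0 P n : (forall q, P n q = false) -> card_avoiders P n = 0.
Proof.
by move=> H; apply/eqP; rewrite cards_eq0; apply/eqP/setP => p; rewrite !inE H andbF.
Qed.

Lemma card_avoiders1 (P : nat -> (nat -> nat) -> bool) n : n <= 1 -> (forall q, P n q) -> card_avoiders P n = 1.
Proof.
move=> n1 H; rewrite /card_avoiders (_ : avoiders P n = setT).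
  by rewrite cardsT card_Sn; case: n n1 {H} => [|[|]].
apply/setP => p; rewrite !inE H andbT; apply/avoids132P => i j k.
by lia.
Qed.

(** Only the decreasing permutation has no arc. In the induction the maximum comes first, so only
    [k = 0] contributes. *)
Lemma card_arcless n : card_avoiders arcless n = 1.
Proof.
elim: n => [|n IH]; first exact: card_avoiders1.
rewrite (@card_avoidersS _ (fun k _ => k == 0) arcless (fun _ _ => false) arcless) //.
  rewrite big_ord_recl /= subn0 IH card_avoiders1 // (card_avoiders0 (n := 0)) //.
  rewrite big1 // => i _; rewrite card_avoiders0 // mul0n.
  by rewrite (card_avoiders0 (P := fun _ => xpred0)).
by move=> k l q1 q2 q H1 H2 G; rewrite (arcless_glue H1 H2 G) orbF.
Qed.

Lemma card_matching0 m : card_avoiders (fun n q => matching n q m.+1) 0 = 0.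
Proof. exact: card_avoiders0. Qed.

(** There is one word of length 0 and one of length 1, so the left block counts as the indicator of
    [k = 0] or of [k = 1]. *)
Lemma card_matchingS m n :
  card_avoiders (fun n q => matching n q m.+1) n.+1 =
  \sum_(k < n.+1)
    ((k == 0 :> nat) * card_avoiders (fun n q => matching n q m.+1) (n - k) +
     (k == 1 :> nat) * card_avoiders (fun n q => matching n q m) (n - k)).
Proof.
rewrite (@card_avoidersS _ (fun k _ => k == 0) (fun n q => matching n q m.+1)
  (fun k _ => k == 1) (fun n q => matching n q m)); first last.
- by move=> k q /eqP ->.
- by move=> k l q1 q2 q H1 H2 G; rewrite (matching_glue H1 H2 G).
apply: eq_bigr => -[[|[|k]] klt] _ //=.
- rewrite card_avoiders1 //.
  by rewrite (card_avoiders0 (P := fun k _ => k == 1)).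
- rewrite (card_avoiders0 (P := fun k _ => k == 0)) //.
  by rewrite (card_avoiders1 (P := fun k _ => k == 1)).
- rewrite (card_avoiders0 (P := fun k _ => k == 0)) //.
  by rewrite (card_avoiders0 (P := fun k _ => k == 1)).
Qed.

Lemma card_matching1 m : card_avoiders (fun n q => matching n q m.+1) 1 = 0.
Proof. by rewrite card_matchingS big_ord1 card_matching0. Qed.

Lemma card_matchingSS m n :
  card_avoiders (fun n q => matching n q m.+1) n.+2 =
  card_avoiders (fun n q => matching n q m.+1) n.+1 +
  card_avoiders (fun n q => matching n q m) n.
Proof.
rewrite card_matchingS 2!big_ord_recl big1 => [|i _]; last by [].
by rewrite /= /bump /= subn0 subn1 /= !mul1n !mul0n !addn0.
Qed.

Lemma card_star0 m : card_avoiders (fun n q => star n q m) 0 = 0.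
Proof. exact: card_avoiders0. Qed.

Lemma card_starS m n :
  card_avoiders (fun n q => star n q m.+1) n.+1 =
  \sum_(k < n.+1) card_avoiders (fun n q => star n q m.+1) k +
  \sum_(k < n.+1) card_avoiders (fun n q => matching n q m.+1) k *
                  card_avoiders edgeless (n - k).
Proof.
rewrite (@card_avoidersS _ arcless (fun n q => star n q m.+1)
  (fun n q => matching n q m.+1) edgeless); first last.
- by move=> k q; apply: arcless_matching.
- by move=> k l q1 q2 q H1 H2 G; rewrite (star_glue H1 H2 G).
rewrite big_split; congr (_ + _) => /=.
(* Reversing the index makes the length [n - k] of the right block the summation variable. *)
rewrite (reindex_inj rev_ord_inj); apply: eq_bigr => k _ /=.
by rewrite card_arcless mul1n subSS subKn // -ltnS.
Qed.

Lemma card_star_rec m n :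
  card_avoiders (fun n q => star n q m.+2) n.+2 =
  card_avoiders (fun n q => star n q m.+2) n.+1 +
  card_avoiders (fun n q => star n q m.+1) n.
Proof.
elim/ltn_ind: n => n IH.
(* Dropping the vanishing terms of lengths 0 and 1 for [n.+2], and of length 0 for [n.+1], pairs
   length [j + 2] in the former sums with [j + 1] in the latter; the arguments of [edgeless] then
   agree. *)
rewrite !card_starS !big_ord_recl /= card_star0 card_matching0 card_matching1.
rewrite /bump /= card_starS !big_ord1 card_star0 card_matching0 !mul0n !add0n.
under eq_bigr => j _ do rewrite IH //.
rewrite big_split /=.
under [X in _ + X = _]eq_bigr => j _ do rewrite card_matchingSS !add1n !subSS mulnDl.
rewrite big_split /=.
(* The sums left over, with [m.+1] and lengths below [n], are the expansion of the last term by
   [card_starS], which needs [n] to be a successor; for [n = 0] everything is 0. *)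
case: n IH => [|n] IH; first by rewrite !big_ord0 card_star0.
rewrite (card_starS m) addnACA; congr (_ + _ + (_ + _)).
Qed.

(** * Stars up to isomorphism *)

Lemma count_iota_card n (P : pred nat) :
  count P (iota 0 n) = #|[set u : 'I_n | P u]|.
Proof.
rewrite -val_enum_ord count_map cardsE cardE /enum_mem size_filter.
by rewrite count_filter; apply: eq_count => u; rewrite !inE andbT.
Qed.

Lemma cwtE n (p : 'S_n) u v : cwt p u v = ncom n (pfun p) u v.
Proof.
rewrite /cwt /ncom count_iota_card; apply: eq_card => x.
by rewrite !inE /arc /narc !pfunE.
Qed.

Lemma cadjE n (p : 'S_n) u v :
  cadj p u v = (u != v) && (0 < ncom n (pfun p) u v).
Proof.
rewrite /cadj -cwtE /cwt card_gt0; congr (_ && _).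
by apply/existsP/set0Pn.
Qed.

(** An isomorphism pulls the centre of the star back to a centre for [star_at]. Conversely, the
    neighbours of a centre are enumerated as leaves and all remaining vertices as isolated ones. *)
Lemma wgiso_star n (p : 'S_n) m :
  [exists k : 'I_n.+1, wgiso (competition_graph p) (star_isolated m k)] =
  star n (pfun p) m.
Proof.
apply/existsP/hasP => [[k /wgisoP[f [[g fK gK] fadj fwt]]]|[c]].
  pose c := g (inl None); have fc : f c = inl None by rewrite gK.
  have adjE u v : sadj (f u) (f v) = (u != v) && (0 < ncom n (pfun p) u v).
    by rewrite -cadjE; apply: fadj.
  exists (val c); first by rewrite mem_iota /= ltn_ord.
  apply/star_atP; split.
  - move=> u un uc; pose u' := Ordinal un.
    case: (posnP (ncom n (pfun p) u c)) => [->//|com0]; have /fwt /= : cadj p u' c by rewrite cadjE uc.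
    by rewrite cwtE => /= <-.
  - move=> u v un vn uc vc uv; pose u' := Ordinal un; pose v' := Ordinal vn.
    apply/eqP; rewrite eqn0Ngt; apply/negP => com0.
    have := adjE u' v'; rewrite -val_eqE /= uv com0 /=.
    (* Every edge of the star contains its centre, and only [c] is mapped there. *)
    have fN (w : 'I_n) : val w != c -> f w <> inl None.
      by move=> wc; rewrite -fc => /(can_inj fK) E; rewrite E eqxx in wc.
    by have := fN u' uc; have := fN v' vc; case: (f u') => [[?|]|?]; case: (f v') => [[?|]|?].
  (* The neighbours of [c] are the image of ['I_m] under the inverse isomorphism. *)
  rewrite count_iota_card -[RHS]card_ord.
  rewrite -(card_imset predT (f := fun i : 'I_m => g (inl (Some i)))); last first.
    by move=> i j /(can_inj gK) [].
  apply: eq_card => u; rewrite !inE val_eqE -adjE fc.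
  apply/idP/imsetP => [|[i _ ->]]; last by rewrite gK.
  case E: (f u) => [[i|]|] //= _; exists i => //.
  by rewrite -E fK.
rewrite mem_iota /= => cn /star_atP[]; pose c' := Ordinal cn.
rewrite count_iota_card; set Lf := [set u : 'I_n | _] => H1 H2 cL.
(* The size of [Is] is the witness for the number of isolated vertices. *)
pose Is := ~: (c' |: Lf).
have cNL : c' \notin Lf by rewrite inE eqxx.
have cI : #|Is| < n.+1 by rewrite ltnS -[X in _ <= X]card_ord max_card.
have cT : (m.+1 + #|Is|) = n.
  by rewrite -[RHS]card_ord -(cardsC (c' |: Lf)) cardsU1 cNL cL.
exists (Ordinal cI); apply/wgisoP => /=.
pose g (x : option 'I_m + 'I_#|Is|) : 'I_n :=
  match x with
  | inl None => c'
  | inl (Some i) => enum_val (cast_ord (esym cL) i)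
  | inr j => enum_val j
  end.
have gL i : g (inl (Some i)) \in Lf by apply: enum_valP.
have gI j : g (inr j) \in Is by apply: enum_valP.
have gIc j : g (inr j) != c' by have := gI j; rewrite !inE negb_or => /andP[].
have gIL j : g (inr j) \notin Lf by have := gI j; rewrite 2!inE negb_or => /andP[].
have ginj : injective g.
  case=> [[i|]|j] [[i'|]|j'] // e.
  - by congr (inl (Some _)); apply: (@cast_ord_inj _ _ (esym cL)); apply: enum_val_inj.
  - by have := gL i; rewrite e (negbTE cNL).
  - by have := gIL j'; rewrite -e gL.
  - by have := gL i'; rewrite -e (negbTE cNL).
  - by have := gIc j'; rewrite -e eqxx.
  - by have := gIL j; rewrite e gL.
  - by have := gIc j; rewrite e eqxx.
  - by congr inr; apply: enum_val_inj.
(* Injectivity suffices, since by [cT] both vertex sets have [n] elements. *)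
have [f gK fK] : bijective g.
  by apply: inj_card_bij; rewrite // card_sum card_option !card_ord cT.
have adjE x y : sadj x y = cadj p (g x) (g y).
  have adjL u : cadj p u c' = (u \in Lf) by rewrite cadjE inE -val_eqE.
  have adj0 u v : u != c' -> v != c' -> cadj p u v = false.
    move=> uc vc; rewrite cadjE; case: eqVneq => //= uv.
    by rewrite H2.
  have gLc i : g (inl (Some i)) != c'.
    by apply: contraNneq cNL => <-; apply: gL.
  case: x y => [[i|]|j] [[i'|]|j']; rewrite [LHS]/=.
  - by rewrite adj0.
  - by rewrite adjL gL.
  - by rewrite adj0.
  - by rewrite cadj_sym adjL gL.
  - by rewrite cadj_irr.
  - by rewrite cadj_sym adjL (negbTE (gIL _)).
  - by rewrite adj0.
  - by rewrite adjL (negbTE (gIL _)).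
  - by rewrite adj0.
have wtE x y : cadj p (g x) (g y) -> cwt p (g x) (g y) = 1.
  have le1 u : u != c' -> ncom n (pfun p) u c' <= 1 by move=> uc; apply: H1.
  move=> xy; move: (xy); rewrite -adjE cwtE.
  have := xy; rewrite cadjE => /andP[] {xy}.
  case: x y => [[i|]|j] [[i'|]|j'] // neq pos _.
    by apply/eqP; rewrite eqn_leq pos le1.
  by apply/eqP; rewrite eqn_leq pos ncomC le1 // eq_sym.
exists f; split; first by exists g.
  by move=> x y; rewrite [LHS]adjE !fK.
by move=> x y; rewrite /= -(fK x) -(fK y) => /wtE ->.
Qed.

Lemma hE m n : h m n = card_avoiders (fun n q => star n q m) n.
Proof. by apply: eq_card => p; rewrite !inE wgiso_star. Qed.

Theorem mainTheorem14 (m n : nat) (hm : 1 < m) (hn : 2 < n) :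
  h m n = h m (n - 1) + h (m - 1) (n - 2).
Proof.
case: m n hm hn => [|[|m]] [|[|n]] // _ _.
by rewrite !hE !subSS !subn0 card_star_rec.
Qed.
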